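(* For every finite graph $G$, letting $k=\omega(G)+1$, we have $\chi_f(G)\le Z_f(G)+R(k,k)$.
   Context: $\omega(G)$ is the maximum size of a clique in $G$, and $R(k,k)$ is the diagonal Ramsey number (the least $N$ such that every graph on $N$ vertices contains a clique or an independent set of size $k$). A fractional coloring of $G$ is an assignment of nonnegative real weights to the independent sets of $G$ such that for every vertex $v$ the total weight of the independent sets containing $v$ is at least $1$; $\chi_f(G)$ is the minimum total weight of a fractional coloring. A fractional cocoloring is defined the same way but weights are assigned to cliques and independent sets, each vertex being covered by total weight at least $1$; $Z_f(G)$ is the minimum total weight of a fractional cocoloring. *)

(* Defs.v *)
From HB Require Import structures.
From mathcomp Require Import all_boot all_order all_algebra.
From mathcomp Require Import boolp classical_sets reals topology normedtype.
From mathcomp Require Import derive.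

Set Implicit Arguments.
Unset Strict Implicit.
Unset Printing Implicit Defensive.

Import Order.TTheory GRing.Theory Num.Theory.
Import numFieldNormedType.Exports.

(* A finite simple graph is a symmetric irreflexive [e : rel T] on a finType. *)

Section Graphs.
Variables (T : finType) (e : rel T).

Definition is_clique (A : {set T}) : bool :=
  [forall x in A, forall y in A, (x != y) ==> e x y].

Definition is_independent (A : {set T}) : bool :=
  [forall x in A, forall y in A, ~~ e x y].

Definition clique_number : nat := \max_(A : {set T} | is_clique A) #|A|.

Definition independent_sets : {set {set T}} :=
  [set A : {set T} | is_independent A].

Definition homogeneous_sets : {set {set T}} :=
  [set A : {set T} | is_clique A || is_independent A].

End Graphs.

Definition ramsey_property (k N : nat) : Prop :=
  forall e : rel 'I_N, symmetric e -> irreflexive e ->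
    exists2 A : {set 'I_N}, #|A| = k & is_clique e A || is_independent e A.

Lemma ramsey_two_colors (s t : nat) : exists N : nat,
  forall (T : finType) (e : rel T) (S : {set T}),
    symmetric e -> irreflexive e -> N <= #|S| ->
    exists2 A : {set T}, A \subset S &
      (#|A| == s) && is_clique e A || (#|A| == t) && is_independent e A.
Proof.
have [n] := ubnP (s + t); elim: n s t => // n IHn [|s] t.
  move=> _; exists 0 => T e S _ _ _; exists finset.set0; rewrite ?finset.sub0set //.
  by rewrite cards0 eqxx; apply/orP; left; apply/forall_inP=> x; rewrite inE.
case: t => [|t] lt_st_n.
  exists 0 => T e S _ _ _; exists finset.set0; rewrite ?finset.sub0set //.
  rewrite cards0 eqxx; apply/orP; right.
  by apply/forall_inP=> x; rewrite inE.
have [|N1 H1] := IHn s t.+1; first by rewrite -ltnS.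
have [|N2 H2] := IHn s.+1 t; first by rewrite -ltnS -addnS.
exists (N1 + N2).+1 => T e S e_sym e_irr leS.
have [x xS] : exists x, x \in S.
  by apply/set0Pn; rewrite -card_gt0 (leq_trans _ leS).
pose S' := S :\ x.
have cardS' : N1 + N2 <= #|S'| by move: leS; rewrite (cardsD1 x) xS.
pose nbr : {set T} := [set y | e x y].
have sub_S (A B : {set T}) : A \subset S' :&: B -> A \subset S.
  by move=> /fintype.subsetP h; apply/fintype.subsetP=> z /h; rewrite !inE => /andP[/andP[]].
have notin (A B : {set T}) : A \subset S' :&: B -> x \notin A.
  by move=> /fintype.subsetP h; apply: contraT => /negbNE/h; rewrite !inE eqxx.
have [le1|gt1] := leqP N1 #|S' :&: nbr|.
  have [A sA] := H1 T e _ e_sym e_irr le1.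
  have AS := sub_S _ _ sA; have xA := notin _ _ sA.
  case/orP=> /andP[/eqP cA hA]; last first.
    by exists A => //; rewrite cA eqxx hA orbT.
  exists (x |: A); first by rewrite finset.subUset finset.sub1set xS.
  rewrite cardsU1 xA cA eqxx /=; apply/orP; left.
  have eA y : y \in A -> e x y by move=> /(fintype.subsetP sA); rewrite !inE => /andP[].
  apply/forall_inP=> y /setU1P[->|yA]; apply/forall_inP=> z /setU1P[->|zA].
  - by rewrite eqxx.
  - by rewrite eA ?implybT.
  - by rewrite e_sym eA ?implybT.
  - by move/forall_inP: hA => /(_ y yA)/forall_inP/(_ z zA).
have le2 : N2 <= #|S' :&: ~: nbr|.
  rewrite -(leq_add2l #|S' :&: nbr|) -finset.setDE cardsID.
  by apply: leq_trans cardS'; rewrite leq_add2r ltnW.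
have [A sA] := H2 T e _ e_sym e_irr le2.
have AS := sub_S _ _ sA; have xA := notin _ _ sA.
case/orP=> /andP[/eqP cA hA].
  by exists A => //; rewrite cA eqxx hA.
exists (x |: A); first by rewrite finset.subUset finset.sub1set xS.
rewrite cardsU1 xA cA eqxx /=; apply/orP; right.
have eA y : y \in A -> ~~ e x y by move=> /(fintype.subsetP sA); rewrite !inE => /andP[].
apply/forall_inP=> y /setU1P[->|yA]; apply/forall_inP=> z /setU1P[->|zA].
- by rewrite e_irr.
- exact: eA.
- by rewrite e_sym eA.
- by move/forall_inP: hA => /(_ y yA)/forall_inP/(_ z zA).
Qed.

Lemma ramsey_exists (k : nat) : exists N, `[< ramsey_property k N >].
Proof.
have [N HN] := ramsey_two_colors k k; exists N; apply/asboolP=> e e_sym e_irr.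
have [|A _ hA] := HN _ e [set: 'I_N] e_sym e_irr.
  by rewrite cardsT card_ord.
by exists A; case/orP: hA => /andP[/eqP // _ ->]; rewrite ?orbT.
Qed.

Definition diagonal_ramsey (k : nat) : nat := ex_minn (ramsey_exists k).

Local Open Scope ring_scope.

Section FractionalCovers.
Variables (R : realType) (T : finType) (F : {set {set T}}).

(* Only the values of [w] on [F] matter. *)
Definition fractional_cover (w : {set T} -> R) : Prop :=
  (forall A, A \in F -> 0 <= w A) /\
  (forall v : T, 1 <= \sum_(A in F | v \in A) w A).

Definition cover_weight (w : {set T} -> R) : R := \sum_(A in F) w A.

(* By [fractional_cover_numberP] below, this infimum is attained, hence is    *)
(* the minimum total weight, as soon as all singletons belong to [F].         *)
Definition fractional_cover_number : R :=
  inf (classical_sets.image fractional_cover cover_weight).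

End FractionalCovers.

Definition fractional_chromatic_number
  (R : realType) (T : finType) (e : rel T) : R :=
  fractional_cover_number R (independent_sets e).

Definition fractional_cochromatic_number
  (R : realType) (T : finType) (e : rel T) : R :=
  fractional_cover_number R (homogeneous_sets e).

Section MinimumAttained.
Local Open Scope classical_set_scope.

Lemma continuous_proj_sum (R : realType) (I : finType) (P : pred I) :
  continuous (fun w : {ptws I -> R} => \sum_(i | P i) w i).
Proof.
apply: (@continuous_big R I +%R 0 P) => [|i _].
  exact: add_continuous.
exact: (@proj_continuous I (fun _ => R) i).
Qed.

Lemma fractional_cover_numberP (R : realType) (T : finType)
    (F : {set {set T}}) : (forall v, [set v]%SET \in F) ->
  exists w : {set T} -> R, [/\ fractional_cover F w,
    cover_weight F w = fractional_cover_number R F &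
    forall w', fractional_cover F w' -> cover_weight F w <= cover_weight F w'].
Proof.
move=> F1; pose X : topologicalType := {ptws {set T} -> R}.
pose K : set X := [set w | forall A, `[0, 1] (w A)].
pose C : set X :=
  \bigcap_(v in [set: T]) [set w | 1 <= \sum_(A in F | v \in A) w A].
have sum_ge1 (w : {set T} -> R) A0 v : (forall A, A \in F -> 0 <= w A) ->
    A0 \in F -> v \in A0 -> 1 <= w A0 -> 1 <= \sum_(A in F | v \in A) w A.
  move=> w0 A0F vA0 wA0; rewrite (bigD1 A0) ?A0F//= -[leLHS]addr0 lerD//.
  by apply: sumr_ge0 => A /andP[/andP[/w0]].
have compactKC : compact (K `&` C).
  apply: compact_closedI.
    apply: (@tychonoff _ (fun _ => R) (fun _ => `[0, 1])) => A.
    exact: segment_compact.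
  apply: closed_bigI => v _.
  apply: (@closed_comp X R (fun w => \sum_(A in F | v \in A) w A) [set x | 1 <= x]).
    by move=> w _; exact: continuous_proj_sum.
  exact: closed_ge.
have KC0 : K `&` C !=set0.
  exists (fun=> 1); split => [A|v _] /=; first by rewrite in_itv/= ler01 lexx.
  by apply: (sum_ge1 (fun=> 1) [set v]%SET) => //; rewrite finset.in_set1.
have [|w /set_mem[Kw Cw] wmin] := @compact_EVT_min X R (cover_weight F) _ KC0 compactKC.
  by apply: continuous_subspaceT; exact: continuous_proj_sum.
have cover_w : fractional_cover F w.
  by split=> [A _|v]; [have /= := Kw A; rewrite in_itv => /andP[]|exact: Cw].
have min_w w' : fractional_cover F w' -> cover_weight F w <= cover_weight F w'.
  move=> [w'0 w'1].
  pose u : X := fun A => if A \in F then Num.min (w' A) 1 else 0.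
  have u0 A : A \in F -> 0 <= u A by move=> AF; rewrite /u AF le_min w'0 ?ler01.
  apply: (@le_trans _ _ (cover_weight F u)); last first.
    by apply: ler_sum => A AF; rewrite /u AF ge_min lexx.
  apply/wmin/mem_set; split => [A|v _] /=.
    rewrite in_itv/= /u; case: ifPn => [AF|_]; last by rewrite lexx ler01.
    by rewrite le_min w'0// ler01 ge_min lexx orbT.
  have [/existsP[A /and3P[AF vA wA]]|/existsPn noA] :=
      boolP [exists A, [&& A \in F, v \in A & 1 <= w' A]].
    by apply: (sum_ge1 u A) => //; rewrite /u AF le_min wA lexx.
  rewrite (eq_bigr w') => [|A /andP[AF vA]]; first exact: w'1.
  have := noA A; rewrite AF vA /= -ltNge => /ltW w1.
  by rewrite /u AF; exact/min_idPl.
exists w; split=> //; apply/le_anti/andP; split.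
  apply: lb_le_inf; first by exists (cover_weight F w); exists w.
  by move=> _ [w' cw' <-]; exact: min_w.
apply: ge_inf; last by exists w.
by exists (cover_weight F w) => _ [w' cw' <-]; exact: min_w.
Qed.

End MinimumAttained.

Lemma fractional_chromatic_numberP (R : realType) (T : finType) (e : rel T) :
  irreflexive e ->
  exists w : {set T} -> R, [/\ fractional_cover (independent_sets e) w,
    cover_weight (independent_sets e) w = fractional_chromatic_number R e &
    forall w', fractional_cover (independent_sets e) w' ->
      cover_weight (independent_sets e) w
        <= cover_weight (independent_sets e) w'].
Proof.
move=> e_irr; apply: fractional_cover_numberP => v; rewrite inE.
by do 2![apply/forall_inP=> ? /set1P->]; rewrite e_irr.
Qed.

Lemma fractional_cochromatic_numberP (R : realType) (T : finType) (e : rel T) :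
  exists w : {set T} -> R, [/\ fractional_cover (homogeneous_sets e) w,
    cover_weight (homogeneous_sets e) w = fractional_cochromatic_number R e &
    forall w', fractional_cover (homogeneous_sets e) w' ->
      cover_weight (homogeneous_sets e) w
        <= cover_weight (homogeneous_sets e) w'].
Proof.
apply: fractional_cover_numberP => v; rewrite inE; apply/orP; left.
by do 2![apply/forall_inP=> ? /set1P->]; rewrite eqxx.
Qed.

(* Main.v *)
(* Start from an optimal fractional cocoloring and keep its independent sets.
   What they leave uncovered is a demand y <= 1 on the vertices with
   \sum_v y v <= (k - 1) * (total weight of the cliques).  As G has no clique of
   size k, any R(k,k) vertices contain an independent set of size k; as long as
   y is nonzero on that many vertices, take such a set and lower y on it until
   some vertex is exhausted.  Each unit of weight spent pays for k units of
   demand, so this costs at most the total weight of the cliques, and fewer than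
   R(k,k) singletons finish the job. *)
Require Import Defs.
From mathcomp Require Import all_boot all_order all_algebra.
From mathcomp Require Import boolp reals.
From mathcomp Require Import lra.

Set Implicit Arguments.
Unset Strict Implicit.
Unset Printing Implicit Defensive.

Import Order.TTheory GRing.Theory Num.Theory.

Local Open Scope ring_scope.

Lemma card_clique_le (T : finType) (e : rel T) (A : {set T}) :
  is_clique e A -> (#|A| <= clique_number e)%N.
Proof. exact: (leq_bigmax_cond (F := fun A : {set T} => #|A|)). Qed.

Lemma is_independent1 (T : finType) (e : rel T) (v : T) :
  irreflexive e -> is_independent e [set v].
Proof. by move=> e_irr; do 2![apply/forall_inP=> ? /set1P->]; rewrite e_irr. Qed.

(** Pulling [e] back along an injection of ['I_N] into [S] makes the Ramsey property apply inside
    [S]; the homogeneous set found there is too large to be a clique. *)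
Lemma independent_subset (T : finType) (e : rel T) (S : {set T}) :
  symmetric e -> irreflexive e ->
  (diagonal_ramsey (clique_number e).+1 <= #|S|)%N ->
  exists A : {set T},
    [/\ is_independent e A, A \subset S & #|A| = (clique_number e).+1].
Proof.
move=> e_sym e_irr; rewrite /diagonal_ramsey; case: ex_minnP => N /asboolP ramN _ leNS.
pose f (i : 'I_N) : T := enum_val (widen_ord leNS i).
have f_inj : injective f by move=> i j /enum_val_inj[/val_inj].
have [||A cA] := ramN (relpre f e); first by move=> i j; exact: e_sym.
  by move=> i; exact: e_irr.
have cfA : #|f @: A| = (clique_number e).+1 by rewrite card_imset.
case/orP=> hA; last first.
  exists (f @: A); split=> //; last first.
    by apply/subsetP=> _ /imsetP[i _ ->]; exact: enum_valP.
  apply/forall_inP=> _ /imsetP[i iA ->]; apply/forall_inP=> _ /imsetP[j jA ->].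
  by move/forall_inP: hA => /(_ i iA)/forall_inP/(_ j jA).
suff /card_clique_le : is_clique e (f @: A) by rewrite cfA ltnn.
apply/forall_inP=> _ /imsetP[i iA ->]; apply/forall_inP=> _ /imsetP[j jA ->].
by rewrite (inj_eq f_inj); move/forall_inP: hA => /(_ i iA)/forall_inP/(_ j jA).
Qed.

(** Induction on the number of vertices with nonzero demand: sets of size [k] are used while at
    least [N] such vertices remain, then singletons. *)
Lemma greedy_fractional_cover (R : realFieldType) (T : finType)
    (F : {set {set T}}) (k N : nat) :
    (0 < k)%N -> (forall v, [set v] \in F) ->
    (forall S : {set T}, (N <= #|S|)%N ->
      exists A : {set T}, [/\ A \in F, A \subset S & #|A| = k]) ->
  forall y : T -> R, (forall v, 0 <= y v <= 1) ->
  exists w : {set T} -> R, [/\ forall A, 0 <= w A,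
    forall v, y v <= \sum_(A in F | v \in A) w A &
    \sum_(A in F) w A <= N%:R + (\sum_v y v) / k%:R].
Proof.
move=> k_gt0 F1 bigF y; have [n] := ubnP #|[set v | y v != 0]|.
elim: n y => // n IHn y ltSn y01; set S := [set v | y v != 0] in ltSn.
have y_ge0 v : 0 <= y v by case/andP: (y01 v).
have [/bigF[A [AF /subsetP sAS cA]] | ltSN] := leqP N #|S|.
  have /set0Pn[v0 v0A] : A != set0 by rewrite -card_gt0 cA.
  (* Subtracting the least demand on [A] keeps every demand nonnegative and brings that of [a] to
     zero, so the support shrinks. *)
  case: (arg_minP y v0A) => a aA a_min; have {}aA : a \in A by [].
  pose y' v := y v - (if v \in A then y a else 0).
  have [|v|w [w_ge0 w_cov w_le]] := IHn y'.
  - rewrite -ltnS; apply: leq_trans ltSn; rewrite ltnS; apply/proper_card/properP.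
    split; last by exists a; [exact: sAS|rewrite inE /y' aA subrr eqxx].
    apply/subsetP=> v; rewrite /S !inE /y'; case: ifP => [/sAS|_].
      by rewrite inE.
    by rewrite subr0.
  - rewrite /y'; case: ifP => [/a_min le_av|_]; last by rewrite subr0.
    by case/andP: (y01 v) (y_ge0 a) => *; lra.
  exists (fun B => w B + (if B == A then y a else 0)); split=> [B|v|].
  - by rewrite addr_ge0//; case: ifP.
  - rewrite big_split /= -big_mkcondr /= -lerBlDr; apply: le_trans (w_cov v).
    rewrite /y' lerB//; case: ifP => vA; last first.
      by apply: sumr_ge0.
    rewrite (big_pred1 A) // => B /=.
    by case: eqP => [->|_]; rewrite ?AF ?vA// andbF.
  - rewrite big_split /= -big_mkcondr /= [X in _ + X <= _](big_pred1 A); last first.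
      by move=> B /=; case: eqP => [->|_]; rewrite ?AF// andbF.
    (* Demand falls by [y a] at each of the [k] vertices of [A], so the quotient by [k] falls by
       exactly the weight spent. *)
    rewrite -lerBrDr; apply: le_trans w_le _; rewrite -addrA lerD2l.
    rewrite sumrB -big_mkcond /= sumr_const cA mulrBl.
    by rewrite -[y a *+ k]mulr_natr mulfK// pnatr_eq0 -lt0n.
(* This weight is [y v] on [[set v]] and zero on all non-singletons. *)
exists (fun A => \sum_(v | A == [set v]) y v); split=> [A|v|].
- exact: sumr_ge0.
- rewrite (bigD1 [set v]) /=; last by rewrite F1 set11.
  rewrite (big_pred1 v) => [|u]; last first.
    by rewrite /= (inj_eq set1_inj) eq_sym.
  by rewrite lerDl; apply: sumr_ge0 => A _; exact: sumr_ge0.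
rewrite (exchange_big_dep predT) //=.
have -> : \sum_v \sum_(A in F | A == [set v]) y v = \sum_(v in S) y v.
  rewrite [RHS]big_mkcond; apply: eq_bigr => v _; rewrite (big_pred1 [set v]).
    by rewrite inE; case: eqP.
  by move=> A /=; case: eqP => [->|]; rewrite ?F1// andbF.
have le1 : \sum_(v in S) y v <= N%:R.
  apply: (@le_trans _ _ (\sum_(v in S) 1)).
    by apply: ler_sum => v _; case/andP: (y01 v).
  by rewrite sumr_const ler_nat ltnW.
by apply: le_trans le1 _; rewrite lerDl divr_ge0// sumr_ge0.
Qed.

Theorem theorem6 (R : realType) (T : finType) (e : rel T)
    (e_sym : symmetric e) (e_irr : irreflexive e) :
  let k := (clique_number e).+1 in
  fractional_chromatic_number R e
    <= fractional_cochromatic_number R e + (diagonal_ramsey k)%:R.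
Proof.
rewrite /=; set k := (clique_number e).+1; set N := diagonal_ramsey k.
have [u [_ <- chi_min]] := fractional_chromatic_numberP R e_irr.
have [z [[z_ge0 z_cov] <- _]] := fractional_cochromatic_numberP R e.
set I := independent_sets e; set H := homogeneous_sets e.
have IH A : A \in I -> A \in H by rewrite !inE => ->; rewrite orbT.
pose x v := \sum_(A in I | v \in A) z A.
(* Sets that are both cliques and independent count only in [x], so [z] splits without overlap. *)
pose c v := \sum_(A in H :\: I | v \in A) z A.
have HI A : (A \in H) && (A \in I) = (A \in I).
  by case: (boolP (A \in I)) => [/IH->|]; rewrite ?andbF.
have HdI A : (A \in H) && (A \notin I) = (A \in H :\: I) by rewrite in_setD andbC.
have xc v : 1 <= x v + c v.
  apply: le_trans (z_cov v) _; rewrite le_eqVlt (bigID (mem I)); apply/orP; left.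
  by apply/eqP; congr (_ + _); apply: eq_bigl => A; rewrite /= andbAC ?HI ?HdI.
have zD_ge0 A : A \in H :\: I -> 0 <= z A by case/setDP=> /z_ge0.
have x_ge0 v : 0 <= x v by apply: sumr_ge0 => A /andP[/IH/z_ge0].
have c_ge0 v : 0 <= c v by apply: sumr_ge0 => A /andP[/zD_ge0].
(* The truncation is needed because [x v] may exceed 1. *)
pose y v := Num.max 0 (1 - x v).
have y01 v : 0 <= y v <= 1.
  by rewrite le_max lexx /= ge_max ler01 lerBlDr lerDl x_ge0.
have y_le v : y v <= c v by rewrite ge_max c_ge0 lerBlDl xc.
have F1 v : [set v] \in I by rewrite inE is_independent1.
have bigI (S : {set T}) : (N <= #|S|)%N ->
    exists A : {set T}, [/\ A \in I, A \subset S & #|A| = k].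
  by move=> /(independent_subset e_sym e_irr)[A [iA sA cA]]; exists A; rewrite inE.
have [w [w_ge0 w_cov w_le]] := greedy_fractional_cover (ltn0Sn _) F1 bigI y01.
apply: le_trans (chi_min (fun A => z A + w A) _) _.
  split=> [A /IH/z_ge0 zA|v]; first exact: addr_ge0.
  rewrite big_split /= -/(x v) -lerBlDl; apply: le_trans (w_cov v).
  by rewrite le_max lexx orbT.
rewrite /cover_weight big_split /= [X in _ <= X + _](bigID (mem I)) /=.
rewrite (eq_bigl _ _ HI) (eq_bigl _ _ HdI) -addrA lerD2l.
apply: le_trans w_le _; rewrite addrC lerD2l ler_pdivrMr ?ltr0n//.
apply: (@le_trans _ _ (\sum_v c v)); first exact: ler_sum.
(* Double counting: each clique [A] contributes [z A] once per vertex, hence at most [k] times. *)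
rewrite (exchange_big_dep (mem (H :\: I))) /=; last by move=> v A _ /andP[].
rewrite mulr_suml; apply: ler_sum => A AD.
rewrite (eq_bigl (mem A)) => [|v]; last by rewrite /= AD.
rewrite sumr_const -[z A *+ _]mulr_natr ler_wpM2l ?zD_ge0// ler_nat.
move: AD; rewrite !inE => /andP[/negPf->]; rewrite orbF => /card_clique_le.
exact: leqW.
Qed.
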